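(* Let $a<b$ be real and $\mathbf n\in\mathbb N^2$. Suppose $\Delta:\mathbf L^{\mathbf n}_{e,[a,b]}\to\mathbf L^{\mathbf n}_{e,[a,b]}$ is an operator given by $(\Delta\mathbf v)(t)=\delta(t)\,\mathbf v(t)$ for some function $\delta:\mathbb R\to\mathbb R$ with $\sup_{t>0}|\delta(t)|\le1$. Then for any PI operators $\mathcal P,\mathcal R$ on $\mathbf Z^{\mathbf n}$ with $\mathcal R^*=-\mathcal R$ and $\mathcal P^*=\mathcal P\ge0$, $\Delta$ satisfies the hard IQC defined by $$\mathcal K=\begin{bmatrix}\mathcal P&\mathcal R\\ \mathcal R^*&-\mathcal P\end{bmatrix}\quad\text{and}\quad\Psi=I.$$
   Context: Signal spaces. For $\mathbf n=(n_1,n_2)\in\mathbb N^2$, $\mathbf Z^{\mathbf n}:=\mathbb R^{n_1}\times L_2^{n_2}[a,b]$ is the real Hilbert space with inner product $\langle(u,U),(v,V)\rangle_{\mathbf Z}=u^Tv+\int_a^bU(s)^TV(s)\,ds$. $\mathbf L^{\mathbf n}_{e,[a,b]}$ is the space of (strongly measurable) functions $\mathbf u:[0,\infty)\to\mathbf Z^{\mathbf n}$ with $\int_0^T\|\mathbf u(t)\|_{\mathbf Z}^2dt<\infty$ for all $T\ge0$; $\langle\mathbf u,\mathbf v\rangle_{\mathbf L}=\int_0^\infty\langle\mathbf u(t),\mathbf v(t)\rangle_{\mathbf Z}dt$ for square-integrable $\mathbf u,\mathbf v$. Stacking $\begin{bmatrix}\mathbf u\\ \mathbf v\end{bmatrix}$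 is component-wise concatenation, identifying $\mathbf Z^{\mathbf n}\times\mathbf Z^{\mathbf n}$ with $\mathbf Z^{2\mathbf n}$; block operators are understood via this identification. $(P_\tau\mathbf y)(t)=\mathbf y(t)$ for $0\le t\le\tau$ and $0$ otherwise; $(M_{\mathcal K}\mathbf w)(t):=\mathcal K\mathbf w(t)$. The function $\delta$ is measurable (so that $\Delta$ is well defined). Hard IQC. $\Delta:\mathbf L^{\mathbf n}_{e,[a,b]}\to\mathbf L^{\mathbf n}_{e,[a,b]}$ satisfies the hard IQC defined by $\Psi:\mathbf L^{2\mathbf n}_{e,[a,b]}\to\mathbf L^{2\mathbf n}_{e,[a,b]}$ and bounded linear $\mathcal K:\mathbf Z^{2\mathbf n}\to\mathbf Z^{2\mathbf n}$ if for all $T>0$ and all $\mathbf v\in\mathbf L^{\mathbf n}_{e,[a,b]}$, $\left\langle P_T\Psi\begin{bmatrix}\mathbf v\\ \Delta\mathbf v\end{bmatrix},P_TM_{\mathcal K}\Psi\begin{bmatrix}\mathbf v\\ \Delta\mathbf v\end{bmatrix}\right\rangle_{\mathbf L}\ge0$. PI operators. A Partial Integral (PI) operator on $\mathbf Z^{\mathbf n}$ is a map of the form $$\begin{bmatrix}x\\ \mathbf x\end{bmatrix}\mapsto\begin{bmatrix}Px+\int_a^bQ_1(s)\mathbf x(s)\,ds\\ Q_2(s)x+R_0(s)\mathbf x(s)+\int_a^sR_1(s,\theta)\mathbf x(\theta)\,d\theta+\int_s^bR_2(s,\theta)\mathbf x(\theta)\,d\theta\end{bmatrix}$$ with $P$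 a matrix, $Q_1,Q_2,R_0$ bounded (measurable) matrix-valued functions and $R_1,R_2$ separable (finite sums of products of a bounded function of $s$ and a bounded function of $\theta$). PI operators are bounded linear operators; $^*$ is the Hilbert space adjoint, and $\mathcal P\ge0$ means $\langle z,\mathcal Pz\rangle\ge0$ for all $z$. *)

(* Defs.v *)
From HB Require Import structures.
From mathcomp Require Import all_boot all_order all_algebra.
From mathcomp Require Import all_classical all_reals all_analysis
  measurable_realfun.
Set Implicit Arguments.
Unset Strict Implicit.
Unset Printing Implicit Defensive.
Import Order.TTheory GRing.Theory Num.Theory.
Import numFieldNormedType.Exports.
Local Open Scope classical_set_scope.
Local Open Scope ring_scope.

Lemma ae_Lnorm2 d (T : measurableType d) (R : realType)
    (mu : {measure set T -> \bar R}) (f g : T -> R) :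
  measurable_fun setT f -> measurable_fun setT g -> f = g %[ae mu] ->
  Lnorm mu 2%:E (EFin \o f) = Lnorm mu 2%:E (EFin \o g).
Proof.
have mabs (h : T -> R) : measurable_fun setT h ->
    measurable_fun setT (fun x => (`|(EFin \o h) x| `^ 2)%E).
  move=> mh; apply: (measurableT_comp (measurable_poweR _)).
  by apply: measurableT_comp => //; exact/measurable_EFinP.
move=> mf mg fg; rewrite unlock; congr (_ `^ _)%E.
apply: ae_eq_integral => //; [exact: mabs|exact: mabs|].
by apply: filterS fg => t /= /[apply] ->.
Qed.

Section interval_L2.
Context {R : realType} (a b : R).

(* Lebesgue measure of the interval [a, b], as a measure on the real line that
   ignores the complement of [a, b] *)
Definition leb_itv : set (measurableTypeR R) -> \bar R :=
  @mrestr _ (measurableTypeR R) R `[a, b] lebesgue_measure (measurable_itv _).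
HB.instance Definition _ := Measure.on leb_itv.

Definition L2 : Type := LspaceType2 leb_itv.
HB.instance Definition _ := gen_eqMixin L2.
HB.instance Definition _ := gen_choiceMixin L2.

Definition L2_fun (f : L2) : measurableTypeR R -> R :=
  aqEqMfun_to_fun (LebesgueSpace.sort f).

Lemma L2_funP (f : L2) : L2_fun f \in Lfun leb_itv 2%:E.
Proof.
apply/andP; split; first exact: (valP (repr (LebesgueSpace.sort f))).
by rewrite inE; exact: (@Lebesgue_finite _ _ _ _ _ _ f).
Qed.

Lemma L2_eq (f g : L2) : L2_fun f = L2_fun g %[ae leb_itv] -> f = g.
Proof.
case: f => f [[mf]]; case: g => g [[mg]].
rewrite /L2_fun/= => fg.
have {}fg : f = g.
  rewrite -(reprK f) -(reprK g); apply/eqmodP => /=.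
  exact/asboolP.
move: mf mg; rewrite fg => mf mg.
by rewrite (Prop_irrelevance mf mg).
Qed.

Lemma L2_ex (f : measurableTypeR R -> R) : f \in Lfun leb_itv 2%:E ->
  {g : L2 | L2_fun g = f %[ae leb_itv]}.
Proof.
move=> /[dup] Lf /andP[mf _].
pose f0 : {mfun measurableTypeR R >-> measurableTypeR R} :=
  HB.pack f (isMeasurableFun.Build _ _ (measurableTypeR R) (measurableTypeR R) f (set_mem mf)).
pose g0 : {mfun_ leb_itv, measurableTypeR R >-> measurableTypeR R} :=
  (\pi_({mfun_ leb_itv, measurableTypeR R >-> measurableTypeR R}) f0)%qT.
have g0f : aqEqMfun_to_fun g0 = f %[ae leb_itv].
  have : repr g0 = f0 %[mod {mfun_ leb_itv, measurableTypeR R >-> measurableTypeR R}]%qT by rewrite reprK.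
  by move/eqmodP/asboolP.
have fing0 : finite_norm leb_itv 2%:E (aqEqMfun_to_fun g0).
  have := Lf => /andP[_]; rewrite inE /= /finite_norm.
  by rewrite (ae_Lnorm2 _ _ g0f)//; [exact: set_mem (valP (repr g0))|exact: set_mem mf].
pose g : LspaceType2 leb_itv :=
  HB.pack g0 (isFinLebesgue.Build _ _ _ _ _ (lee1n 2) g0 fing0).
by exists g.
Qed.

(* [L2_class] is only characterized up to a.e. equality, hence so are the
   vector space operations below, see [L2_eq] *)
Definition L2_class f Lf : L2 := projT1 (@L2_ex f Lf).

Lemma L2_classE f Lf : L2_fun (@L2_class f Lf) = f %[ae leb_itv].
Proof. exact: projT2 (L2_ex Lf). Qed.

Lemma L2_add_Lfun (f g : L2) : L2_fun f \+ L2_fun g \in Lfun leb_itv 2%:E.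
Proof. exact: ((Lfun_addr_closed leb_itv (lee1n 2)).2 _ _ (L2_funP f) (L2_funP g)). Qed.

Lemma L2_scale_Lfun r (f : L2) : r \o* L2_fun f \in Lfun leb_itv 2%:E.
Proof. by apply: Lfun_scale; [rewrite ler1n|exact: L2_funP]. Qed.

Lemma L2_zero_Lfun : cst 0 \in Lfun leb_itv 2%:E.
Proof. exact: (Lfun_addr_closed leb_itv (lee1n 2)).1. Qed.

Definition L2_zero : L2 := L2_class L2_zero_Lfun.
Definition L2_add f g : L2 := L2_class (L2_add_Lfun f g).
Definition L2_scale r f : L2 := L2_class (L2_scale_Lfun r f).
Definition L2_opp := L2_scale (-1).

Lemma L2_zeroE : L2_fun L2_zero = cst 0 %[ae leb_itv].
Proof. exact: L2_classE. Qed.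

Lemma L2_addE f g : L2_fun (L2_add f g) = L2_fun f \+ L2_fun g %[ae leb_itv].
Proof. exact: L2_classE. Qed.

Lemma L2_scaleE r f : L2_fun (L2_scale r f) = r \o* L2_fun f %[ae leb_itv].
Proof. exact: L2_classE. Qed.

Fact L2_addA : associative L2_add.
Proof.
move=> f g h; apply: L2_eq.
apply: filterS2 (filterI (L2_addE f (L2_add g h)) (L2_addE g h))
  (filterI (L2_addE (L2_add f g) h) (L2_addE f g)).
by move=> x [/(_ I)/= -> /(_ I)/= ->] [/(_ I)/= -> /(_ I)/= ->] _; rewrite addrA.
Qed.

Fact L2_addC : commutative L2_add.
Proof.
move=> f g; apply: L2_eq; apply: filterS2 (L2_addE f g) (L2_addE g f).
by move=> x /(_ I)/= -> /(_ I)/= -> _; rewrite addrC.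
Qed.

Fact L2_add0 : left_id L2_zero L2_add.
Proof.
move=> f; apply: L2_eq; apply: filterS2 (L2_addE L2_zero f) L2_zeroE.
by move=> x /(_ I)/= -> /(_ I)/= -> _; rewrite add0r.
Qed.

Fact L2_addN : left_inverse L2_zero L2_opp L2_add.
Proof.
move=> f; apply: L2_eq.
apply: filterS3 (L2_addE (L2_opp f) f) (L2_scaleE (-1) f) L2_zeroE.
by move=> x /(_ I)/= -> /(_ I)/= -> /(_ I)/= -> _; rewrite mulrN1 addNr.
Qed.

HB.instance Definition _ :=
  GRing.isZmodule.Build L2 L2_addA L2_addC L2_add0 L2_addN.

Fact L2_scaleA r q (f : L2) : L2_scale r (L2_scale q f) = L2_scale (r * q) f.
Proof.
apply: L2_eq; apply: filterS3 (L2_scaleE r (L2_scale q f)) (L2_scaleE q f)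
  (L2_scaleE (r * q) f).
move=> x /(_ I)/= -> /(_ I)/= -> /(_ I)/= -> _.
by rewrite -mulrA (mulrC q).
Qed.

Fact L2_scale1 : left_id 1 L2_scale.
Proof.
move=> f; apply: L2_eq; apply: filterS (L2_scaleE 1 f).
by move=> x /(_ I)/= -> _; rewrite mulr1.
Qed.

Fact L2_scaleDr : right_distributive L2_scale +%R.
Proof.
move=> r f g; apply: L2_eq.
apply: filterS3 (filterI (L2_scaleE r (f + g)) (L2_addE f g))
  (L2_addE (L2_scale r f) (L2_scale r g))
  (filterI (L2_scaleE r f) (L2_scaleE r g)).
move=> x [/(_ I)/= -> /(_ I)/= ->] /(_ I)/= -> [/(_ I)/= -> /(_ I)/= ->] _.
by rewrite mulrDl.
Qed.

Fact L2_scaleDl (f : L2) : {morph L2_scale^~ f : r q / r + q}.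
Proof.
move=> r q; apply: L2_eq.
apply: filterS3 (L2_scaleE (r + q) f)
  (L2_addE (L2_scale r f) (L2_scale q f))
  (filterI (L2_scaleE r f) (L2_scaleE q f)).
move=> x /(_ I)/= -> /(_ I)/= -> [/(_ I)/= -> /(_ I)/= ->] _.
by rewrite mulrDr.
Qed.

HB.instance Definition _ := GRing.Zmodule_isLmodule.Build R L2
  L2_scaleA L2_scale1 L2_scaleDr L2_scaleDl.

End interval_L2.

Section signal_space.
Context {R : realType} (a b : R).
Local Notation leb := (@lebesgue_measure R).
Local Notation leb_ab := (leb_itv a b).

Definition Zsp (n : nat * nat) : Type := 'cV[R]_n.1 * {ffun 'I_n.2 -> L2 a b}.
HB.instance Definition _ n := GRing.Lmodule.on (Zsp n).

Definition eval_vec m (U : {ffun 'I_m -> L2 a b}) (s : R) : 'cV[R]_m :=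
  \col_i L2_fun (U i) s.

Definition Zinner n (z w : Zsp n) : R :=
  (z.1^T *m w.1) 0 0 +
  \int[leb_ab]_s ((eval_vec z.2 s)^T *m eval_vec w.2 s) 0 0.

Definition Znorm n (z : Zsp n) : R := Num.sqrt (Zinner z z).

Definition double_dim (n : nat * nat) : nat * nat :=
  ((n.1 + n.1)%N, (n.2 + n.2)%N).

Definition stack n (z w : Zsp n) : Zsp (double_dim n) :=
  (col_mx z.1 w.1,
   [ffun i : 'I_(n.2 + n.2) => match fintype.split i with
                               | inl j => z.2 j
                               | inr j => w.2 j
                               end]).

Definition stack_fst n (z : Zsp (double_dim n)) : Zsp n :=
  (usubmx z.1, [ffun j : 'I_n.2 => z.2 (lshift n.2 j)]).

Definition stack_snd n (z : Zsp (double_dim n)) : Zsp n :=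
  (dsubmx z.1, [ffun j : 'I_n.2 => z.2 (rshift n.2 j)]).

Definition block_op n (A B C D : Zsp n -> Zsp n)
    (z : Zsp (double_dim n)) : Zsp (double_dim n) :=
  stack (A (stack_fst z) + B (stack_snd z))
        (C (stack_fst z) + D (stack_snd z)).

Definition bounded_linear n m (A : Zsp n -> Zsp m) : Prop :=
  linear A /\ exists C, forall z, Znorm (A z) <= C * Znorm z.

Definition is_adjoint n m (A : Zsp n -> Zsp m) (B : Zsp m -> Zsp n) : Prop :=
  forall z w, Zinner (A z) w = Zinner z (B w).

Definition nonneg_op n (A : Zsp n -> Zsp n) : Prop :=
  forall z, 0 <= Zinner z (A z).

(* Borel coefficients lose no generality: [is_PI] below is insensitive to
   modifications of the coefficients on negligible sets *)
Definition bounded_measurable m k (F : R -> 'M[R]_(m, k)) : Prop :=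
  (forall i j, measurable_fun `[a, b] (fun s => F s i j)) /\
  exists C, forall s, s \in `[a, b] -> forall i j, `|F s i j| <= C.

Definition separable_kernel m (F : R -> R -> 'M[R]_m) : Prop :=
  exists N (G H : 'I_N -> R -> 'M[R]_m),
    [/\ forall k, bounded_measurable (G k),
        forall k, bounded_measurable (H k) &
        forall s theta, s \in `[a, b] -> theta \in `[a, b] ->
          F s theta = \sum_k G k s *m H k theta].

Definition vec_integral m (D : set R) (f : R -> 'cV[R]_m) : 'cV[R]_m :=
  \col_i \int[leb_ab]_(s in D) f s i 0.

Definition is_PI n (A : Zsp n -> Zsp n) : Prop :=
  exists (P : 'M[R]_n.1) (Q1 : R -> 'M[R]_(n.1, n.2))
    (Q2 : R -> 'M[R]_(n.2, n.1)) (R0 : R -> 'M[R]_n.2)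
    (R1 R2 : R -> R -> 'M[R]_n.2),
    [/\ [/\ bounded_measurable Q1, bounded_measurable Q2 &
            bounded_measurable R0],
        separable_kernel R1, separable_kernel R2 &
        forall z : Zsp n,
          (A z).1 = P *m z.1 +
            vec_integral `[a, b] (fun s => Q1 s *m eval_vec z.2 s) /\
          {ae leb_ab, forall s, s \in `[a, b] ->
            eval_vec (A z).2 s =
              Q2 s *m z.1 + R0 s *m eval_vec z.2 s +
              vec_integral `[a, s]
                (fun theta => R1 s theta *m eval_vec z.2 theta) +
              vec_integral `[s, b]
                (fun theta => R2 s theta *m eval_vec z.2 theta)}].

Definition simple_signal n (u : R -> Zsp n) : Prop :=
  finite_set (u @` `[0, +oo[) /\
  forall z, measurable (`[0, +oo[ `&` u @^-1` [set z]).

(* Borel simple functions with a.e. convergence: this is strong measurability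
   for the completed Lebesgue sigma-algebra *)
Definition strongly_measurable n (u : R -> Zsp n) : Prop :=
  exists phi : nat -> R -> Zsp n,
    (forall k, simple_signal (phi k)) /\
    {ae leb, forall t, 0 <= t ->
      (fun k => Znorm (phi k t - u t)) @ \oo --> (0 : R)}.

(* A function on [0, +oo[ is encoded by its extension by zero to the real
   line, so that equality of signals is equality on [0, +oo[ *)
Definition Le n : set (R -> Zsp n) :=
  [set u | [/\ forall t, t < 0 -> u t = 0,
               strongly_measurable u &
               forall T, 0 <= T ->
                 (\int[leb]_(t in `[0%R, T]) ((Znorm (u t)) ^+ 2)%:E < +oo)%E]].

Definition Linner n (u v : R -> Zsp n) : R :=
  \int[leb]_(t in `[0, +oo[) Zinner (u t) (v t).

Definition truncation (tau : R) n (y : R -> Zsp n) : R -> Zsp n :=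
  fun t => if 0 <= t <= tau then y t else 0.

Definition mult_op n m (K : Zsp n -> Zsp m) (w : R -> Zsp n) : R -> Zsp m :=
  fun t => K (w t).

Definition stack_signal n (u v : R -> Zsp n) : R -> Zsp (double_dim n) :=
  fun t => stack (u t) (v t).

Definition hard_IQC n (Delta : {fun @Le n >-> @Le n})
    (Psi : {fun @Le (double_dim n) >-> @Le (double_dim n)})
    (K : Zsp (double_dim n) -> Zsp (double_dim n)) : Prop :=
  bounded_linear K /\
  forall T, 0 < T -> forall v, Le v ->
    let y := Psi (stack_signal v (Delta v)) in
    0 <= Linner (truncation T y) (truncation T (mult_op K y)).

End signal_space.

(* Measurability with respect to Lebesgue (not only Borel) measurable sets *)
Definition lebesgue_measurable (R : realType) (f : R -> R) : Prop :=
  forall B : set R, measurable B ->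
    completed_algebra_gen (@lebesgue_measure R) (f @^-1` B).

(* Main.v *)
(** Pointwise in time, with [z = v t] and [c = delta t], adjointness and
    skewness give
    [<[z; c z], K [z; c z]> = <z, P z> + c <z, R z> - c <z, R z> - c^2 <z, P z>
      = (1 - c^2) <z, P z> >= 0],
    except possibly at [t = 0], which the bound on [delta] does not cover.
    Boundedness of [K] reduces to that of [P] and [R].  An operator with an
    adjoint is linear, so it is enough to bound a PI operator on the unit ball,
    where the integral terms are controlled by [|x| <= 1 + x ^ 2] rather than
    by the Cauchy-Schwarz inequality. *)

Require Import Defs.
From HB Require Import structures.
From mathcomp Require Import all_boot all_order all_algebra.
From mathcomp Require Import all_classical all_reals all_analysis.
From mathcomp Require Import measurable_realfun ring lra.
Import Order.TTheory GRing.Theory Num.Theory.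
Import numFieldNormedType.Exports.
Local Open Scope classical_set_scope.
Local Open Scope ring_scope.

(** * Comparison of integrals without measurability of the integrand *)

Section nonmeasurable_integral.
Context d (T : measurableType d) (R : realType)
  (mu : {measure set T -> \bar R}).

(** The integral of a nonnegative function is a supremum over the simple functions below it, and
    every simple function below [f] is below [g]. Hence the comparison applies to integrands whose
    measurability has not been established. *)
Lemma nonmeasurable_ge0_le_integral (f g : T -> \bar R) :
  (forall x, 0 <= f x)%E -> (forall x, f x <= g x)%E ->
  (\int[mu]_x f x <= \int[mu]_x g x)%E.
Proof.
move=> f0 fg; have g0 x : (0 <= g x)%E := le_trans (f0 x) (fg x).
rewrite !ge0_integralTE//; apply: ereal_sup_le => _ [h hf <-].
by exists h => // x; exact: le_trans (hf x) (fg x).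
Qed.

(** The positive and negative parts of [f] on [D] both lie between 0 and [g], so their integrals are
    two reals in [[0, c]], where [c] is the finite integral of [g]. Their difference then lies in
    [[-c, c]]. *)
Lemma nonmeasurable_le_normr_Rintegral (D : set T) (f g : T -> R) :
  mu.-integrable setT (EFin \o g) -> (forall x, 0 <= g x) ->
  (forall x, D x -> `|f x| <= g x) ->
  `|\int[mu]_(x in D) f x| <= \int[mu]_x g x.
Proof.
move=> ig g0 fg; rewrite Rintegral_mkcond /Rintegral.
have ffg x : `|(f \_ D) x| <= g x.
  by rewrite patchE; case: ifPn => [/set_mem /fg//|_]; rewrite normr0.
rewrite integralE.
set p := (X in (X - _)%E); set q := (X in (_ - X)%E).
have p0 : (0 <= p)%E by apply: integral_ge0.
have q0 : (0 <= q)%E by apply: integral_ge0.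
have pg : (p <= \int[mu]_x (g x)%:E)%E.
  apply: nonmeasurable_ge0_le_integral => // x.
  rewrite funeposE ge_max !lee_fin g0 andbT.
  exact: le_trans (ler_norm _) (ffg x).
have qg : (q <= \int[mu]_x (g x)%:E)%E.
  apply: nonmeasurable_ge0_le_integral => // x.
  rewrite funenegE -EFinN ge_max !lee_fin g0 andbT.
  by apply: le_trans (ffg x); rewrite -normrN ler_norm.
have := integrable_fin_num measurableT ig.
move: p q (\int[mu]_x _)%E p0 q0 pg qg => [p||] [q||] [c||]//=.
by rewrite !lee_fin ler_norml => ? ? ? ? _; apply/andP; split; lra.
Qed.

(* The negative part of [f] lives on [x0], hence is measurable even if [f] is
   not. *)
Lemma Rintegral_ge0_except_point (x0 : T) (f : T -> R) (D : set T) :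
  measurable [set x0] -> mu [set x0] = 0%E ->
  (forall x, D x -> x <> x0 -> 0 <= f x) -> 0 <= \int[mu]_(x in D) f x.
Proof.
move=> m0 mu0 f0; rewrite Rintegral_mkcond /Rintegral fine_ge0// integralE.
rewrite [X in (_ - X)%E](_ : _ = 0%E); first by rewrite sube0 integral_ge0.
apply/eqP; rewrite eq_le integral_ge0// andbT.
(* Zero is written as the integral of a constant over the null set [[set x0]]; this integrand
   dominates the negative part everywhere. *)
have <- : (\int[mu]_(x in [set x0]) (`|(f \_ D) x0|%:E) = 0)%E.
  by rewrite integral_cst// mu0 mule0.
rewrite [leRHS]integral_mkcond; apply: nonmeasurable_ge0_le_integral => // x.
rewrite [leRHS]patchE; case: ifPn => [/set_mem ->|/negP x0x].
  rewrite funenegE -EFinN ge_max !lee_fin normr_ge0 andbT.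
  by rewrite -normrN ler_norm.
rewrite funenegE -EFinN ge_max !lee_fin lexx andbT oppr_le0 patchE.
case: ifPn => // /set_mem Dx; apply: f0 => // xx0.
by apply: x0x; rewrite inE.
Qed.

Lemma ae_eq_Rintegral (f g : T -> R) :
  measurable_fun setT f -> measurable_fun setT g ->
  {ae mu, forall x, f x = g x} -> \int[mu]_x f x = \int[mu]_x g x.
Proof.
move=> mf mg fg; congr fine; apply: ae_eq_integral => //.
- exact/measurable_EFinP.
- exact/measurable_EFinP.
- by apply: filterS fg => x /= ->.
Qed.

End nonmeasurable_integral.

(** * The inner product of $L_2[a,b]$ *)

Section L2_inner.
Context {R : realType} {a b : R}.
Local Notation mu := (@leb_itv R a b).
Implicit Types (f g h : L2 a b).

(** Finite mass makes constants integrable, so that affine functions of [energy] can serve as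
    majorants below. *)
Lemma leb_itv_fin : fin_num_fun mu.
Proof.
apply: lty_fin_num_fun.
rewrite /= /leb_itv /mrestr setTI lebesgue_measure_itv/=.
by case: ifP => _; rewrite ?ltry// -EFinD ltry.
Qed.

HB.instance Definition _ := @Measure_isFinite.Build _ _ _ mu leb_itv_fin.

Lemma leb_itv_ae : {ae mu, forall s, s \in `[a, b]}.
Proof.
exists (~` `[a, b]); split.
- by apply: measurableC.
- by rewrite /leb_itv /mrestr setICl measure0.
- by move=> x /= xab abx; apply: xab.
Qed.

Definition L2_inner f g : R := \int[mu]_s (L2_fun f s * L2_fun g s).

Lemma measurable_L2_fun f : measurable_fun setT (L2_fun f).
Proof. by have /andP[/set_mem] := L2_funP f. Qed.

Lemma integrable_L2_mul f g :
  mu.-integrable setT (EFin \o (fun s => L2_fun f s * L2_fun g s)).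
Proof. by apply/Lfun1_integrable; exact: Lfun2_mul_Lfun1 (L2_funP f) (L2_funP g). Qed.

Lemma L2_innerC f g : L2_inner f g = L2_inner g f.
Proof. by apply: eq_Rintegral => s _; rewrite mulrC. Qed.

(** The representative chosen for [f + g] is the sum of the representatives only almost everywhere,
    so linearity has to pass through an a.e. equality of integrands. *)
Lemma L2_innerDl f g h : L2_inner (f + g) h = L2_inner f h + L2_inner g h.
Proof.
rewrite /L2_inner -RintegralD//; [|exact: integrable_L2_mul..].
have ? := measurable_L2_fun.
apply: ae_eq_Rintegral.
- exact: measurable_funM.
- by apply: measurable_funD; apply: measurable_funM.
- by apply: filterS (L2_addE f g) => s /(_ I)/= ->; rewrite mulrDl.
Qed.

Lemma L2_innerZl c f g : L2_inner (c *: f) g = c * L2_inner f g.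
Proof.
rewrite /L2_inner -RintegralZl//; [|exact: integrable_L2_mul].
have ? := measurable_L2_fun.
apply: ae_eq_Rintegral.
- exact: measurable_funM.
- by apply: measurable_funM => //; apply: measurable_funM.
- by apply: filterS (L2_scaleE c f) => s /(_ I)/= ->; ring.
Qed.

Lemma L2_inner_ge0 f : 0 <= L2_inner f f.
Proof. by apply: Rintegral_ge0 => s _; rewrite -expr2 sqr_ge0. Qed.

(** A vanishing integral of the nonnegative function $f^2$ forces $f^2 = 0$ a.e., and elements of
    [L2] that agree a.e. are equal. *)
Lemma L2_inner_eq0 f : L2_inner f f = 0 -> f = 0.
Proof.
move=> f0; apply: L2_eq.
have : (\int[mu]_s `|(EFin \o (fun s => (L2_fun f s * L2_fun f s)%R)) s| = 0)%E.
  under eq_integral do rewrite /= ger0_norm -?expr2 ?sqr_ge0//.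
  rewrite -[LHS]fineK; last exact: integrable_fin_num (integrable_L2_mul f f).
  by congr EFin; rewrite -[RHS]f0; congr fine; apply: eq_integral => s _; rewrite expr2.
have mf := measurable_L2_fun f.
move/ae_eq_integral_abs => /(_ measurableT) ff0.
have {}ff0 : ae_eq mu setT (EFin \o (fun s => L2_fun f s * L2_fun f s)) (cst 0%E).
  by apply: ff0; apply/measurable_EFinP; exact: measurable_funM.
apply: filterS2 (L2_zeroE a b) ff0 => s /(_ I)/= -> /(_ I)/= [] /eqP.
by rewrite mulf_eq0 orbb => /eqP.
Qed.

End L2_inner.

(** * The inner product of $\mathbf Z^{\mathbf n}$, stacking and adjoints *)

Section signal_inner.
Context {R : realType} {a b : R}.
Local Notation mu := (@leb_itv R a b).
Local Notation Zsp := (Zsp a b).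

Lemma Rintegral_sum_L2_mul k (F G : 'I_k -> L2 a b) :
  \int[mu]_s (\sum_j L2_fun (F j) s * L2_fun (G j) s) =
  \sum_j L2_inner (F j) (G j).
Proof.
rewrite /Rintegral; under eq_integral do rewrite -sumEFin.
rewrite integral_sum//; last by move=> j; exact: integrable_L2_mul.
rewrite -sum_fine//.
by move=> j _; exact: integrable_fin_num (integrable_L2_mul _ _).
Qed.

(** In this coordinate form, symmetry, bilinearity and definiteness reduce to those of finite sums
    and of [L2_inner]. *)
Lemma ZinnerE {n} (z w : Zsp n) :
  Zinner z w = \sum_i z.1 i 0 * w.1 i 0 + \sum_j L2_inner (z.2 j) (w.2 j).
Proof.
rewrite /Zinner mxE; under eq_bigr do rewrite mxE.
congr (_ + _); rewrite -Rintegral_sum_L2_mul.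
apply: eq_Rintegral => s _.
by rewrite mxE; under eq_bigr do rewrite !mxE.
Qed.

Lemma ZinnerC {n} (z w : Zsp n) : Zinner z w = Zinner w z.
Proof.
rewrite !ZinnerE; congr (_ + _); apply: eq_bigr => i _.
- by rewrite mulrC.
- by rewrite L2_innerC.
Qed.

Lemma ZinnerDl {n} (z w u : Zsp n) : Zinner (z + w) u = Zinner z u + Zinner w u.
Proof.
rewrite !ZinnerE addrACA -!big_split/=.
congr (_ + _); apply: eq_bigr => i _.
- by rewrite mxE mulrDl.
- by rewrite ffunE L2_innerDl.
Qed.

Lemma ZinnerZl {n} c (z w : Zsp n) : Zinner (c *: z) w = c * Zinner z w.
Proof.
rewrite !ZinnerE mulrDr !mulr_sumr.
congr (_ + _); apply: eq_bigr => i _.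
- by rewrite mxE mulrA.
- by rewrite ffunE L2_innerZl.
Qed.

Lemma ZinnerNl {n} (z w : Zsp n) : Zinner (- z) w = - Zinner z w.
Proof. by rewrite -scaleN1r ZinnerZl mulN1r. Qed.

Lemma Zinner0l {n} (z : Zsp n) : Zinner 0 z = 0.
Proof. by rewrite -(scale0r 0) ZinnerZl mul0r. Qed.

Lemma ZinnerDr {n} (z w u : Zsp n) : Zinner u (z + w) = Zinner u z + Zinner u w.
Proof. by rewrite ZinnerC ZinnerDl !(ZinnerC u). Qed.

Lemma ZinnerZr {n} c (z w : Zsp n) : Zinner z (c *: w) = c * Zinner z w.
Proof. by rewrite ZinnerC ZinnerZl ZinnerC. Qed.

Lemma ZinnerNr {n} (z w : Zsp n) : Zinner z (- w) = - Zinner z w.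
Proof. by rewrite ZinnerC ZinnerNl ZinnerC. Qed.

Lemma Zinner_ge0 {n} (z : Zsp n) : 0 <= Zinner z z.
Proof.
rewrite ZinnerE addr_ge0// sumr_ge0// => i _.
- by rewrite -expr2 sqr_ge0.
- exact: L2_inner_ge0.
Qed.

Lemma Zinner_eq0 {n} (z : Zsp n) : Zinner z z = 0 -> z = 0.
Proof.
move=> /eqP; rewrite ZinnerE paddr_eq0 ?sumr_ge0//; last 2 first.
- by move=> i _; rewrite -expr2 sqr_ge0.
- by move=> j _; exact: L2_inner_ge0.
rewrite !psumr_eq0; last 2 first.
- by move=> j _; exact: L2_inner_ge0.
- by move=> i _; rewrite -expr2 sqr_ge0.
case: z => z1 z2 /= /andP[/allP z10 /allP z20]; congr pair.
- apply/matrixP => i j; rewrite ord1 mxE.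
  by have /= := z10 i (mem_index_enum i); rewrite mulf_eq0 orbb => /eqP.
- apply/ffunP => j; rewrite ffunE.
  by have /=/eqP/L2_inner_eq0 := z20 j (mem_index_enum j).
Qed.

Lemma Znorm_sqr {n} (z : Zsp n) : Znorm z ^+ 2 = Zinner z z.
Proof. by rewrite sqr_sqrtr// Zinner_ge0. Qed.

(** Expanding $0 \le \|z-w\|^2$ gives $2\langle z,w\rangle \le \|z\|^2+\|w\|^2$. This takes the
    place of the triangle inequality. *)
Lemma ZinnerD_le {n} (z w : Zsp n) :
  Zinner (z + w) (z + w) <= 2 * Zinner z z + 2 * Zinner w w.
Proof.
have := Zinner_ge0 (z - w).
rewrite !(ZinnerDl, ZinnerDr, ZinnerNl, ZinnerNr) (ZinnerC w z); lra.
Qed.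

Lemma Zinner_stack {n} (z w z' w' : Zsp n) :
  Zinner (stack z w) (stack z' w') = Zinner z z' + Zinner w w'.
Proof.
rewrite !ZinnerE !big_split_ord/= addrACA; congr (_ + _ + (_ + _));
  apply: eq_bigr => i _.
- by rewrite !col_mxEu.
- by rewrite !ffunE (unsplitK (inl i)).
- by rewrite !col_mxEd.
- by rewrite !ffunE (unsplitK (inr i)).
Qed.

Lemma stack_fst_stack {n} (z w : Zsp n) : stack_fst (stack z w) = z.
Proof.
case: z => z1 z2; rewrite /stack_fst /stack /= col_mxKu; congr pair.
by apply/ffunP => j; rewrite !ffunE (unsplitK (inl j)).
Qed.

Lemma stack_snd_stack {n} (z w : Zsp n) : stack_snd (stack z w) = w.
Proof.
case: w => w1 w2; rewrite /stack_snd /stack /= col_mxKd; congr pair.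
by apply/ffunP => j; rewrite !ffunE (unsplitK (inr j)).
Qed.

Lemma Zinner_double {n} (z w : Zsp (double_dim n)) :
  Zinner z w = Zinner (stack_fst z) (stack_fst w) +
               Zinner (stack_snd z) (stack_snd w).
Proof.
rewrite !ZinnerE !big_split_ord/= addrACA; congr (_ + _ + (_ + _));
  apply: eq_bigr => i _; by rewrite ?mxE ?ffunE.
Qed.

(** The defect of linearity [u] is tested against itself. Moving [A] to the other side as [B] leaves
    an expression that cancels by linearity of the inner product in its first argument, so $\|u\|^2
    = 0$. *)
Lemma adjoint_linear {n m} {A : Zsp n -> Zsp m} {B} : is_adjoint A B -> linear A.
Proof.
move=> AB c z w; apply/eqP; rewrite -subr_eq0; apply/eqP/Zinner_eq0.
set u := A _ - _.
rewrite {1}/u ZinnerDl ZinnerNl !(ZinnerDl, ZinnerZl, AB).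
by rewrite subrr.
Qed.

End signal_inner.

(** * Boundedness of PI operators *)

Section PI_boundedness.
Context {R : realType} {a b : R}.
Local Notation mu := (@leb_itv R a b).
Local Notation Zsp := (Zsp a b).

Lemma L2_inner_le_ae (f : L2 a b) (g : R -> R) :
  mu.-integrable setT (EFin \o g) -> (forall s, 0 <= g s) ->
  {ae mu, forall s, L2_fun f s ^+ 2 <= g s} ->
  L2_inner f f <= \int[mu]_s g s.
Proof.
move=> ig g0 fg; apply: fine_le.
- exact: integrable_fin_num (integrable_L2_mul f f).
- exact: integrable_fin_num ig.
apply: ae_ge0_le_integral => //.
- by move=> s _; rewrite lee_fin -expr2 sqr_ge0.
- exact: (measurable_int mu (integrable_L2_mul f f)).
- by move=> s _; rewrite lee_fin.
- exact: (measurable_int mu ig).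
- by apply: filterS fg => s /= fg _; rewrite lee_fin -expr2.
Qed.

Lemma mulmx_entry_le {m p k} {M : 'M[R]_(m, p)} {N : 'M[R]_(p, k)} {C e} i j :
  (forall l, `|M i l| <= C) -> (forall l, `|N l j| <= e) ->
  `|(M *m N) i j| <= C * e * p%:R.
Proof.
move=> MC Ne; rewrite mxE (le_trans (ler_norm_sum _ _ _))//.
rewrite (le_trans (ler_sum (G := fun=> C * e) _ _))//.
  by move=> l _; rewrite normrM ler_pM.
by rewrite sumr_const card_ord mulr_natr.
Qed.

Lemma bounded_measurable_bound {m k} {F : R -> 'M[R]_(m, k)} :
  bounded_measurable a b F ->
  exists2 C, 0 <= C & forall s, s \in `[a, b] -> forall i j, `|F s i j| <= C.
Proof.
case=> _ [C FC]; exists `|C| => // s sab i j.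
exact: le_trans (FC s sab i j) (ler_norm C).
Qed.

Lemma separable_kernel_bound {m} {F : R -> R -> 'M[R]_m} :
  separable_kernel a b F ->
  exists2 C, 0 <= C & forall s theta, s \in `[a, b] -> theta \in `[a, b] ->
    forall i j, `|F s theta i j| <= C.
Proof.
case=> N [G [H [bG bH FE]]].
have [CG CGP] := choice (fun k => (bG k).2).
have [CH CHP] := choice (fun k => (bH k).2).
(* The factor [m] counts the products in one entry of [G k s *m H k theta]; the outer absolute value
   makes the constant nonnegative whatever the signs of [CG] and [CH]. *)
exists `|\sum_k CG k * CH k * m%:R| => // s theta sab tab i j.
apply: le_trans (ler_norm _); rewrite FE// summxE.
rewrite (le_trans (ler_norm_sum _ _ _))// ler_sum// => k _.
apply: mulmx_entry_le => l; [exact: CGP|exact: CHP].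
Qed.

(** The squared Euclidean norm of the value at [s]: an integrable function that dominates the square
    of every component. *)
Definition energy {k} (U : {ffun 'I_k -> L2 a b}) (s : R) : R :=
  \sum_j L2_fun (U j) s ^+ 2.

Lemma energy_ge0 {k} (U : {ffun 'I_k -> L2 a b}) s : 0 <= energy U s.
Proof. by apply: sumr_ge0 => j _; rewrite sqr_ge0. Qed.

Lemma L2_fun_le_energy {k} (U : {ffun 'I_k -> L2 a b}) j s :
  L2_fun (U j) s ^+ 2 <= energy U s.
Proof.
rewrite /energy (bigD1 j)//= lerDl sumr_ge0// => i _.
exact: sqr_ge0.
Qed.

Lemma integrable_energy {k} (U : {ffun 'I_k -> L2 a b}) :
  mu.-integrable setT (EFin \o energy U).
Proof.
rewrite [X in _.-integrable _ X](_ : _ =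
  fun s => (\sum_j (L2_fun (U j) s * L2_fun (U j) s)%:E)%E).
  by apply: integrable_sum => // j _; exact: integrable_L2_mul.
apply/funext => s; rewrite /= /energy -sumEFin.
by apply: eq_bigr => j _; rewrite expr2.
Qed.

Lemma Rintegral_energy_le n (z : Zsp n) : \int[mu]_s energy z.2 s <= Zinner z z.
Proof.
rewrite ZinnerE -Rintegral_sum_L2_mul ler_wpDl//.
by apply: sumr_ge0 => i _; rewrite -expr2 sqr_ge0.
Qed.

Let mass := fine (mu setT).

Let integrable_energyZ {k} (U : {ffun 'I_k -> L2 a b}) (d : R) :
  mu.-integrable setT (EFin \o (fun s => d * energy U s)).
Proof. exact: (integrableZl measurableT d (integrable_energy U)). Qed.

Let integrable_affine {k} (U : {ffun 'I_k -> L2 a b}) (c d : R) :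
  mu.-integrable setT (EFin \o (fun s => c + d * energy U s)).
Proof.
have ic := finite_measure_integrable_cst mu c measurableT.
exact: (integrableD measurableT ic (integrable_energyZ U d)).
Qed.

Lemma Rintegral_affine_energy {k} (U : {ffun 'I_k -> L2 a b}) (c d : R) :
  \int[mu]_s (c + d * energy U s) = c * mass + d * \int[mu]_s energy U s.
Proof.
have ic := finite_measure_integrable_cst mu c measurableT.
rewrite (RintegralD measurableT ic (integrable_energyZ U d)).
by rewrite Rintegral_cst// RintegralZl//; exact: integrable_energy.
Qed.

(** By $|x| \le 1 + x^2$, each entry of the integrand is at most $Ck(1 + \mathrm{energy})$. The set
    [D] is left general to serve [[a, b]], [[a, s]] and [[s, b]]. The bound is not homogeneous in
    [U], hence the restriction to the unit ball below. *)
Lemma vec_integral_le {m k} {M : R -> 'M[R]_(m, k)} {D : set R} {C}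
    (U : {ffun 'I_k -> L2 a b}) i :
  0 <= C -> (forall s, D s -> forall i j, `|M s i j| <= C) ->
  `|vec_integral a b D (fun s => M s *m eval_vec U s) i 0| <=
  C * k%:R * (mass + \int[mu]_s energy U s).
Proof.
move=> C0 MC; rewrite mxE.
have Ck0 : 0 <= C * k%:R by rewrite mulr_ge0.
rewrite mulrDr -Rintegral_affine_energy.
apply: nonmeasurable_le_normr_Rintegral.
- exact: integrable_affine.
- by move=> s; rewrite addr_ge0 ?mulr_ge0 ?energy_ge0.
move=> s Ds.
apply: le_trans (mulmx_entry_le (C := C) (e := 1 + energy U s) i 0 _ _) _.
- by move=> l; exact: MC.
- move=> l; rewrite mxE.
  apply: le_trans (_ : 1 + `|L2_fun (U l) s| ^+ 2 <= _).
    by have := normr_ge0 (L2_fun (U l) s); nra.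
  by rewrite lerD2l real_normK ?num_real// L2_fun_le_energy.
- by rewrite mulrAC mulrDr mulr1.
Qed.

Lemma PI_bounded_ball {n} {A : Zsp n -> Zsp n} : is_PI A ->
  exists K, forall z, Zinner z z <= 1 -> Zinner (A z) (A z) <= K.
Proof.
case=> P [Q1 [Q2 [R0 [R1 [R2 [[bQ1 bQ2 bR0] bR1 bR2 AE]]]]]].
have [C1 C10 C1P] := bounded_measurable_bound bQ1.
have [C2 C20 C2P] := bounded_measurable_bound bQ2.
have [C0 C00 C0P] := bounded_measurable_bound bR0.
have [D1 D10 D1P] := separable_kernel_bound bR1.
have [D2 D20 D2P] := separable_kernel_bound bR2.
pose CP := \sum_i \sum_j `|P i j|.
have CPP i j : `|P i j| <= CP.
  rewrite /CP (bigD1 i)//= (bigD1 j)//= -addrA lerDl addr_ge0 ?sumr_ge0//.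
  by move=> k _; rewrite sumr_ge0.
have mass0 : 0 <= mass by rewrite fine_ge0.
set k1 : R := n.1%:R; set k2 : R := n.2%:R.
(* [X] bounds the entries of the finite-dimensional output. [Y] bounds pointwise every term of the
   function output except $R_0\mathbf x$, which is controlled only in mean square. The factors [1]
   bound the entries of [z.1], and those in [mass + 1] bound the integrated energy. *)
pose X := CP * 1 * k1 + C1 * k2 * (mass + 1).
pose Y := C2 * 1 * k1 + D1 * k2 * (mass + 1) + D2 * k2 * (mass + 1).
exists (\sum_(i < n.1) X ^+ 2 +
        \sum_(i < n.2) (2 * Y ^+ 2 * mass + 2 * (C0 * k2) ^+ 2 * 1)) => z z1.
have [Az1 Az2] := AE z.
have E1 := le_trans (Rintegral_energy_le _ z) z1.
(* The square of one coordinate is a single term of the nonnegative sum [Zinner z z]. *)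
have z1i i : `|z.1 i 0| <= 1.
  rewrite -(@ler_pXn2r _ 2)// ?nnegrE// real_normK ?num_real// expr1n.
  apply: le_trans z1; rewrite ZinnerE (bigD1 i)//= -expr2 -addrA lerDl.
  rewrite addr_ge0 ?sumr_ge0// => k _; first by rewrite -expr2 sqr_ge0.
  exact: L2_inner_ge0.
have vecK m C (M : R -> 'M[R]_(m, n.2)) D i : 0 <= C ->
    (forall s, D s -> forall i j, `|M s i j| <= C) ->
    `|vec_integral a b D (fun s => M s *m eval_vec z.2 s) i 0| <=
    C * k2 * (mass + 1).
  move=> C_ge0 MC; apply: le_trans (vec_integral_le _ _ C_ge0 MC) _.
  by rewrite ler_wpM2l ?mulr_ge0// lerD2l.
rewrite ZinnerE lerD// ler_sum// => i _.
- rewrite -expr2 -real_normK ?num_real// lerXn2r// ?nnegrE//.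
    by rewrite addr_ge0 ?mulr_ge0 ?addr_ge0 ?sumr_ge0// => k _; rewrite sumr_ge0.
  rewrite Az1 mxE (le_trans (ler_normD _ _))// lerD//.
    exact: mulmx_entry_le.
  by apply: vecK.
(* With $q(s)$ the pointwise bound for the $R_0$ term, the majorant is $2Y^2 + 2q(s)^2$; as $q^2$ is
   a multiple of the energy, it integrates to the announced constant. *)
- apply: le_trans (L2_inner_le_ae _
    (fun s => 2 * Y ^+ 2 + 2 * (C0 * k2) ^+ 2 * energy z.2 s) _ _ _) _.
  + exact: integrable_affine.
  + move=> s; rewrite addr_ge0// mulr_ge0 ?energy_ge0 ?sqr_ge0//.
    by rewrite mulr_ge0 ?sqr_ge0.
  + apply: (@filterS2 _ _ (ae_filter_ringOfSetsType mu)) leb_itv_ae Az2.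
    move=> s sab /(_ sab) Azs.
    have -> : L2_fun ((A z).2 i) s = eval_vec (A z).2 s i 0 by rewrite mxE.
    pose e := Num.sqrt (energy z.2 s).
    have Ue l : `|eval_vec z.2 s l 0| <= e.
      by rewrite mxE -sqrtr_sqr ler_wsqrtr// L2_fun_le_energy.
    have R0e : `|(R0 s *m eval_vec z.2 s) i 0| <= C0 * e * k2.
      by apply: mulmx_entry_le => // l; exact: C0P.
    have Q2z : `|(Q2 s *m z.1) i 0| <= C2 * 1 * k1.
      by apply: mulmx_entry_le => // l; exact: C2P.
    (* Both integration windows stay inside [[a, b]], where the kernel bounds hold. *)
    have sub1 theta : `[a, s]%classic theta -> theta \in `[a, b].
      move: sab; rewrite /= !in_itv/= => /andP[_ sb] /andP[-> ts].
      exact: le_trans sb.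
    have sub2 theta : `[s, b]%classic theta -> theta \in `[a, b].
      move: sab; rewrite /= !in_itv/= => /andP[as_ _] /andP[st ->].
      by rewrite (le_trans as_ st).
    have I1 := vecK _ D1 (fun theta => R1 s theta) `[a, s]%classic i D10
      (fun theta Dt => D1P s theta sab (sub1 theta Dt)).
    have I2 := vecK _ D2 (fun theta => R2 s theta) `[s, b]%classic i D20
      (fun theta Dt => D2P s theta sab (sub2 theta Dt)).
    rewrite {}Azs; set y := (X in X i 0 ^+ 2).
    have -> : 2 * Y ^+ 2 + 2 * (C0 * k2) ^+ 2 * energy z.2 s =
              2 * Y ^+ 2 + 2 * (C0 * e * k2) ^+ 2.
      by rewrite -[energy _ _]sqr_sqrtr ?energy_ge0// -/e; ring.
    rewrite -real_normK ?num_real//.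
    have xY : `|y i 0| <= Y + C0 * e * k2.
      rewrite /y [X in `|X|]mxE [X in `|X + _|]mxE [X in `|X + _ + _|]mxE.
      rewrite (le_trans (ler_normD _ _))// (le_trans (lerD (ler_normD _ _) I2))//.
      rewrite (le_trans (lerD (lerD (ler_normD _ _) I1) (lexx _)))// /Y; lra.
    have := normr_ge0 (y i 0).
    (* This is $(Y+q)^2 \le 2Y^2 + 2q^2$ with $q = C_0 e k_2$. *)
    have := sqr_ge0 (Y - C0 * e * k2).
    move: xY; set w := `|_|; nra.
  + rewrite Rintegral_affine_energy lerD2l ler_wpM2l//.
    by rewrite mulr_ge0 ?sqr_ge0.
Qed.

(** Homogeneity extends the bound on the unit ball to all [z] by normalization; a vector of norm
    zero is the zero vector and is treated apart. *)
Lemma PI_bounded {n} {A : Zsp n -> Zsp n} : is_PI A -> linear A ->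
  exists2 K, 0 <= K & forall z, Zinner (A z) (A z) <= K * Zinner z z.
Proof.
move=> /PI_bounded_ball[K AK] linA.
have AZ c z : A (c *: z) = c *: A z := scalable_linear linA c z.
exists `|K| => // z.
have [z0|z0] := eqVneq (Zinner z z) 0.
  rewrite z0 mulr0 (Zinner_eq0 z z0) -(scale0r 0) AZ scale0r.
  by rewrite Zinner0l.
have zgt0 : 0 < Znorm z.
  by rewrite sqrtr_gt0 lt_neqAle eq_sym z0 Zinner_ge0.
have zE : z = Znorm z *: ((Znorm z)^-1 *: z).
  by rewrite scalerA divff ?gt_eqF// scale1r.
rewrite {1 2}zE AZ ZinnerZl ZinnerZr mulrA -expr2 Znorm_sqr mulrC.
rewrite ler_wpM2r ?Zinner_ge0//; apply: le_trans (ler_norm K).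
apply: AK; rewrite ZinnerZl ZinnerZr mulrA -expr2 exprVn Znorm_sqr.
by rewrite mulVf.
Qed.

End PI_boundedness.

(** * Linearity and boundedness of the block operator *)

Section block_operator.
Context {R : realType} {a b : R} {n : nat * nat}.
Local Notation Zsp := (Zsp a b).

Lemma stackD (z w z' w' : Zsp n) :
  stack (z + z') (w + w') = stack z w + stack z' w'.
Proof.
rewrite /stack; congr pair; first by rewrite /= add_col_mx.
by apply/ffunP => j; rewrite !ffunE; case: fintype.split => k; rewrite ffunE.
Qed.

Lemma stackZ c (z w : Zsp n) : stack (c *: z) (c *: w) = c *: stack z w.
Proof.
rewrite /stack; congr pair; first by rewrite /= scale_col_mx.
by apply/ffunP => j; rewrite !ffunE; case: fintype.split => k; rewrite ffunE.
Qed.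

Lemma stack_fst_linear : linear (@stack_fst R a b n).
Proof.
move=> c z w; congr pair; first by apply/matrixP => i j; rewrite !mxE.
by apply/ffunP => j; rewrite !ffunE.
Qed.

Lemma stack_snd_linear : linear (@stack_snd R a b n).
Proof.
move=> c z w; congr pair; first by apply/matrixP => i j; rewrite !mxE.
by apply/ffunP => j; rewrite !ffunE.
Qed.

Lemma block_op_linear (A B C D : Zsp n -> Zsp n) :
  linear A -> linear B -> linear C -> linear D -> linear (block_op A B C D).
Proof.
move=> lA lB lC lD c z w.
rewrite /block_op stack_fst_linear stack_snd_linear lA lB lC lD.
by rewrite -stackZ -stackD; congr stack; rewrite scalerDr addrACA.
Qed.

Lemma bounded_linear_skew_block (P Q : Zsp n -> Zsp n) :
  is_PI P -> linear P -> is_PI Q -> linear Q ->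
  bounded_linear (block_op P Q (\- Q) (\- P)).
Proof.
move=> PI_P lP PI_Q lQ.
have lN (A : Zsp n -> Zsp n) : linear A -> linear (\- A).
  by move=> lA c z w; rewrite /= lA opprD scalerN.
split; first by apply: block_op_linear => //; exact: lN.
have [KP KP0 PK] := PI_bounded PI_P lP.
have [KQ KQ0 QK] := PI_bounded PI_Q lQ.
(* The rows have squared norms at most $2K_P\|x\|^2 + 2K_Q\|y\|^2$ and $2K_Q\|x\|^2 + 2K_P\|y\|^2$,
   with sum $2(K_P+K_Q)(\|x\|^2+\|y\|^2)$. The root appears because [KP] and [KQ] bound squared
   norms. *)
exists (Num.sqrt (2 * (KP + KQ))) => z.
rewrite -sqrtrM ?mulr_ge0 ?addr_ge0// ler_wsqrtr//.
rewrite /block_op Zinner_stack /= (Zinner_double z z).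
set x := stack_fst z; set y := stack_snd z.
have := ZinnerD_le (P x) (Q y).
have := ZinnerD_le (- Q x) (- P y).
rewrite !(ZinnerNl, ZinnerNr) !opprK.
move: (PK x) (PK y) (QK x) (QK y).
move: (Zinner x x) (Zinner y y) (Zinner (P x) (P x)) (Zinner (P y) (P y))
  (Zinner (Q x) (Q x)) (Zinner (Q y) (Q y)) (Zinner (_ + _) _) (Zinner _ _).
by move=> *; lra.
Qed.

End block_operator.

(** * Sign of the quadratic form at almost every time *)

Theorem corollary11 (R : realType) (a b : R) (hab : a < b) (n : nat * nat)
  (Delta : {fun @Le R a b n >-> @Le R a b n})
  (delta : R -> R) (mdelta : lebesgue_measurable delta)
  (delta_le1 : (ereal_sup [set `|delta t|%:E | t in `]0%R, +oo[] <= 1)%E)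
  (DeltaE : forall v, Le v -> forall t, 0 <= t -> Delta v t = delta t *: v t)
  (P Rop Radj : Zsp a b n -> Zsp a b n)
  (PI_P : is_PI P) (PI_R : is_PI Rop)
  (adj_R : is_adjoint Rop Radj) (skew_R : Radj = \- Rop)
  (adj_P : is_adjoint P P) (P_ge0 : nonneg_op P) :
  hard_IQC Delta idfun (block_op P Rop Radj (\- P)).
Proof.
have lP := adjoint_linear adj_P; have lR := adjoint_linear adj_R.
subst Radj; split; first exact: bounded_linear_skew_block.
have PZ c z : P (c *: z) = c *: P z := scalable_linear lP c z.
have RZ c z : Rop (c *: z) = c *: Rop z := scalable_linear lR c z.
move=> T T0 v Lv /=.
apply: (@Rintegral_ge0_except_point _ _ _ lebesgue_measure 0).
- exact: measurable_set1.
- exact: lebesgue_measure_set1.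
move=> t; rewrite /= in_itv/= andbT => t0 tn0.
(* Outside [[0, T]] both truncated signals vanish, and so does the integrand. *)
rewrite /truncation; case: ifPn => _; last by rewrite Zinner0l.
rewrite /mult_op /stack_signal (DeltaE v Lv t t0).
have {tn0}t_gt0 : 0 < t by rewrite lt_neqAle t0 eq_sym andbT; apply/eqP.
have delta_t : `|delta t| <= 1.
  rewrite -lee_fin; apply: le_trans delta_le1.
  by apply: ereal_sup_ubound; exists t => //=; rewrite in_itv/= t_gt0.
rewrite /block_op stack_fst_stack stack_snd_stack Zinner_stack /=.
rewrite PZ RZ !(ZinnerDr, ZinnerZl, ZinnerZr, ZinnerNr).
have := P_ge0 (v t); move: delta_t; rewrite ler_norml => /andP[? ?] ?.
(* The cross terms in [Rop] cancel. Writing $1 - c^2$ as $(1-c)(1+c)$ exposes factors that are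
   nonnegative by $|c| \le 1$. *)
rewrite [leRHS](_ : _ = (1 - delta t) * (1 + delta t) * Zinner (v t) (P (v t))).
  by rewrite !mulr_ge0//; lra.
by ring.
Qed.
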